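(* Let $\widetilde{\mathrm{tol}}>0$ be a given Greedy tolerance. For $\mu\in\mathcal D$ use the error measure $\mathbb E(x,\tilde x):=\|\mathcal B(\mu)(x-\tilde x)\|_{\mathcal Y'}$ for the snapshot computation, and assume that the RB-approximations $u_n^\varepsilon(\mu)\in X_n^\varepsilon$ are computed as the Petrov–Galerkin solutions $$b(u_n^\varepsilon(\mu),w;\mu)=\langle f(\mu),w\rangle_{\mathcal Y'\times\mathcal Y}\quad\forall\,w\in Y_n^\varepsilon(\mu):=\mathcal R_{\mathcal Y}'\,\mathcal B(\mu)(X_n^\varepsilon).$$ Let the snapshot tolerances be $$\varepsilon(\mu):=\widetilde{\mathrm{tol}}\,\frac{c_\Delta}{C_\Delta}\,\beta(\mu).$$ Then: if AdaptGreedy terminates through its stopping criterion with some $N<N_{\max}$ (i.e. it returns $X_N^\varepsilon$), then $$\max_{\mu\in\mathcal D_{\mathrm{train}}}\|e_N^\varepsilon(\mu)\|_{\mathcal X}<\widetilde{\mathrm{tol}}.$$ In particular, if multiple selection of snapshots occurs, i.e. if $\mu^{n+1}\in S_n$ for some $n$, then AdaptGreedy terminates through its stopping criterion.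
   Context: Setting. $\mathcal X,\mathcal Y$ are real Hilbert spaces with duals $\mathcal X',\mathcal Y'$; $\mathcal D\subset\mathbb R^P$ is a set of parameters and $\mathcal D_{\mathrm{train}}\subset\mathcal D$ is a finite training set. For each $\mu\in\mathcal D$, $\mathcal B(\mu):\mathcal X\to\mathcal Y'$ is a bounded linear operator with bilinear form $b(w,v;\mu)=\langle\mathcal B(\mu)w,v\rangle_{\mathcal Y'\times\mathcal Y}$, satisfying $b(w,v;\mu)\le\gamma(\mu)\|w\|_{\mathcal X}\|v\|_{\mathcal Y}$ with $\gamma(\mu)\le\gamma^{UB}<\infty$, and the Nečas condition $$\beta(\mu)=\inf_{w\in\mathcal X}\sup_{v\in\mathcal Y}\frac{b(w,v;\mu)}{\|w\|_{\mathcal X}\|v\|_{\mathcal Y}}=\inf_{v\in\mathcal Y}\sup_{w\in\mathcal X}\frac{b(w,v;\mu)}{\|w\|_{\mathcal X}\|v\|_{\mathcal Y}}\ge\beta_{LB}>0$$ (nonzero elements). For $f(\mu)\in\mathcal Y'$, $u(\mu)\in\mathcal X$ is the unique solution of $\mathcal B(\mu)u(\mu)=f(\mu)$. Riesz operator. $\mathcal R_{\mathcal Y}:\mathcal Y'\to\mathcal Y$ is defined by $\langle\mathcal R_{\mathcal Y}y',z'\rangle_{\mathcal Y\times\mathcal Y'}=(y',z')_{\mathcal Y'}$ for $y',z'\in\mathcal Y'$ (it is the Riesz representation operator), and $\mathcal R_{\mathcal Y}':\mathcal Y'\to\mathcal Y$ is its adjoint, $\langle\mathcal R_{\mathcal Y}'y',z'\rangle_{\mathcal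 Y\times\mathcal Y'}=\langle\mathcal R_{\mathcal Y}z',y'\rangle_{\mathcal Y\times\mathcal Y'}=(y',z')_{\mathcal Y'}$. Equivalently, $y=\mathcal R_{\mathcal Y}'\mathcal B(\mu)w$ is the element of $\mathcal Y$ with $(y,z)_{\mathcal Y}=b(w,z;\mu)$ for all $z\in\mathcal Y$. Snapshots. A snapshot for $\mu$ is an element $u^\varepsilon(\mu)\in\mathcal X$ with $\mathbb E(u(\mu),u^\varepsilon(\mu))\le\varepsilon(\mu)$, where $\varepsilon(\mu)>0$ is the prescribed tolerance. For selected parameters $\mu^1,\dots,\mu^n$, $S_n=\{\mu^1,\dots,\mu^n\}$ and $X_n^\varepsilon=\mathrm{span}\{u^\varepsilon(\mu^i):1\le i\le n\}$ ($X_0^\varepsilon=\{0\}$) is the reduced basis (RB) space. The RB error is $e_n^\varepsilon(\mu):=u(\mu)-u_n^\varepsilon(\mu)$. Error estimators. $\Delta_n^\varepsilon(\mu):=\|f(\mu)-\mathcal B(\mu)u_n^\varepsilon(\mu)\|_{\mathcal Y'}/\beta(\mu)$. A surrogate $\overline\Delta_n^\varepsilon(\mu)$ is assumed to be available with constants $0<c_\Delta\le C_\Delta$ such that $c_\Delta\Delta_n^\varepsilon(\mu)\le\overline\Delta_n^\varepsilon(\mu)\le C_\Delta\Delta_n^\varepsilon(\mu)$ for all $\mu\in\mathcal D$ and all $n$. Algorithm AdaptGreedy (inputs $\widetilde{\mathrm{tol}}$, $N_{\max}$, $\varepsilon(\cdot)$, $\mathcal D_{\mathrm{train}}$). Start with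 $S_0=\emptyset$. For $n=0,1,\dots,N_{\max}-1$: choose $\mu^{n+1}\in\arg\max_{\mu\in\mathcal D_{\mathrm{train}}}\overline\Delta_n^\varepsilon(\mu)$; if $\overline\Delta_n^\varepsilon(\mu^{n+1})<c_\Delta\,\widetilde{\mathrm{tol}}$ (stopping criterion), return $X_n^\varepsilon$; otherwise set $S_{n+1}=S_n\cup\{\mu^{n+1}\}$, compute a snapshot $u^\varepsilon(\mu^{n+1})$ and set $X_{n+1}^\varepsilon=X_n^\varepsilon+\mathrm{span}\{u^\varepsilon(\mu^{n+1})\}$. ''Terminates with $N<N_{\max}$'' means that the stopping criterion is met and $X_N^\varepsilon$ is returned.
   Formalization: The final claim is false when the surrogate equals the threshold exactly; the formal version concludes that the algorithm terminates by its stopping criterion, or the surrogate at the reselected parameter equals c_Δ·tol and its snapshot error equals ε(μ) exactly. *)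

(* Defs.v *)
From HB Require Import structures.
From mathcomp Require Import all_boot all_order all_algebra finmap.
From mathcomp Require Import sesquilinear.
From mathcomp Require Import all_classical all_reals all_analysis.

Set Implicit Arguments.
Unset Strict Implicit.
Unset Printing Implicit Defensive.

Import Order.TTheory GRing.Theory Num.Theory.
Import numFieldNormedType.Exports.

Local Open Scope classical_set_scope.
Local Open Scope ring_scope.

Section Dual.
Context {R : realType} {Y : normedModType R}.

Definition is_dual : {pred Y -> R^o} :=
  mem [set f : Y -> R^o | linear f /\ continuous f].

Lemma is_dual_submod : submod_closed is_dual.
Proof.
split.
  rewrite inE; split; first by move=> a x y /=; rewrite scaler0 addr0.
  exact: cst_continuous.
move=> a f g; rewrite !inE => -[lf cf] [lg cg]; split.
  move=> k x y.
  have -> z : (a *: f + g) z = a *: f z + g z by [].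
  rewrite lf lg !scalerDr !addrA; congr (_ + _); rewrite -!addrA; congr (_ + _).
    by rewrite !scalerA mulrC.
  by rewrite addrC.
move=> x; apply: (@cvgD _ R^o); last exact: cg.
by apply: (@cvgZr _ R^o); exact: cf.
Qed.

HB.instance Definition _ :=
  GRing.isSubmodClosed.Build R (Y -> R^o) is_dual is_dual_submod.

End Dual.

Record dual (R : realType) (Y : normedModType R) :=
  Dual { dual_fun :> Y -> R^o; dual_funP : dual_fun \in is_dual }.

Section DualLmod.
Context {R : realType} {Y : normedModType R}.
HB.instance Definition _ := [isSub for @dual_fun R Y].
HB.instance Definition _ := [Choice of dual Y by <:].
HB.instance Definition _ := [SubChoice_isSubLmodule of dual Y by <:].
End DualLmod.

Section DualNorm.
Context {R : realType} {Y : normedModType R}.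

(* For [Y] trivial the set is empty and [sup set0 = 0]. *)
Definition dual_norm (f : dual Y) : R :=
  sup [set `|f y| / `|y| | y in [set y : Y | y != 0]].

(* Polarization: the inner product of the dual is the one inducing [dual_norm]
   when the norm of [Y] comes from an inner product. *)
Definition dual_dot (f g : dual Y) : R :=
  (dual_norm (f + g) ^+ 2 - dual_norm (f - g) ^+ 2) / 4.

(* [xget] selects the element satisfying the defining equation; it exists and
   is unique in a Hilbert space, so the default value [0] plays no role. *)
Definition riesz (f : dual Y) : Y :=
  xget 0 [set y : Y | forall g : dual Y, g y = dual_dot f g].

Definition riesz_adj (f : dual Y) : Y :=
  xget 0 [set y : Y | forall g : dual Y, g y = f (riesz g)].

End DualNorm.

(* Both the infimum and the suprema are real-valued and range over nonzero
   vectors; they are genuine bounds as soon as [b] is a bounded form and both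
   spaces are nontrivial, and if [U] is trivial the value is [inf set0 = 0]. *)
Definition infsup (R : realType) (U V : normedModType R) (b : U -> V -> R) : R :=
  inf [set sup [set b w v / (`|w| * `|v|) | v in [set v : V | v != 0]]
      | w in [set w : U | w != 0]].

Definition lin_span (R : realType) (X : lmodType R) (s : seq X) : set X :=
  [set x | exists c : 'I_(size s) -> R, x = \sum_(i < size s) c i *: s`_i].

Section ReducedBasis.
Context {R : realType} {X Y : normedModType R}.

Definition residual_error (B : {linear X -> dual Y}) (x x' : X) : R :=
  dual_norm (B (x - x')).

Definition error_estimator (B : {linear X -> dual Y}) (f : dual Y) (x : X) : R :=
  dual_norm (f - B x) / infsup (fun w v => B w v).

Definition petrov_galerkin (B : {linear X -> dual Y}) (f : dual Y)
    (Xn : set X) (x : X) : Prop :=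
  Xn x /\ forall w : Y, [set riesz_adj (B z) | z in Xn] w -> B x w = f w.

End ReducedBasis.

(* One run of the greedy algorithm.  [mu_ i] is the i-th selected parameter,
   i >= 1 ([mu_ 0] is never used), [est n] is the estimator maximized in
   iteration [n] and [thr] is the threshold of the stopping criterion.  Values
   of [mu_] and [est] beyond the end of the run are irrelevant. *)
Section Greedy.
Context {R : realType} {T : choiceType}.
Variables (Dtrain : {fset T}) (Nmax : nat) (thr : R).
Variables (est : nat -> T -> R) (mu_ : nat -> T).

Definition selected (n : nat) : seq T := [seq mu_ i | i <- iota 1 n].

Definition stops (n : nat) : bool := est n (mu_ n.+1) < thr.

(* The n-th reduced space is built during the run. *)
Definition reached (n : nat) : Prop :=
  (n <= Nmax)%N /\ forall k, (k < n)%N -> ~~ stops k.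

Definition executed (n : nat) : Prop := reached n /\ (n < Nmax)%N.

Definition argmax (g : T -> R) : set T :=
  [set mu | mu \in Dtrain /\ forall nu, nu \in Dtrain -> g nu <= g mu].

Definition greedy_run : Prop :=
  forall n, executed n -> argmax (est n) (mu_ n.+1).

Definition terminates (N : nat) : Prop := executed N /\ stops N.

End Greedy.

(* Main.v *)
(* The inf-sup condition gives beta |w| <= |B w|, so the estimator dominates the
   error and the stopping criterion bounds the error by the tolerance.  The test
   space is chosen so that the Petrov-Galerkin solution minimizes the dual norm
   of the residual over the reduced space.  If a parameter is selected twice,
   its snapshot lies in the reduced space, so the residual is at most the
   snapshot tolerance, whence the surrogate is at most c_Delta * tol: either it
   is smaller and the run stops, or all these inequalities are equalities. *)
Require Import Defs.
From HB Require Import structures.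
From mathcomp Require Import all_boot all_order all_algebra finmap.
From mathcomp Require Import sesquilinear.
From mathcomp Require Import all_classical all_reals all_analysis.
From mathcomp Require Import ring lra.

Set Implicit Arguments.
Unset Strict Implicit.
Unset Printing Implicit Defensive.

Import Order.TTheory GRing.Theory Num.Theory.
Import numFieldNormedType.Exports.

Local Open Scope classical_set_scope.
Local Open Scope ring_scope.

(** * Continuous functionals, their dual norm and the inf-sup constant *)

Section DualTheory.
Context {R : realType} {Y : normedModType R}.
Implicit Types (f g : dual Y) (y z : Y).

Lemma dual_linear f : linear (dual_fun f).
Proof. by have := dual_funP f; rewrite inE => -[]. Qed.

Lemma dual_continuous f : continuous (dual_fun f).
Proof. by have := dual_funP f; rewrite inE => -[]. Qed.

HB.instance Definition _ f :=
  GRing.isLinear.Build R Y R^o _ (dual_fun f) (dual_linear f).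

Lemma dualD f y z : f (y + z) = f y + f z.
Proof. exact: linearD. Qed.

Lemma dualZ f (a : R) y : f (a *: y) = a * f y.
Proof. exact: (linearZ_LR (f : {linear Y -> R^o})). Qed.

Lemma dualB f g y : (f - g) y = f y - g y.
Proof. by []. Qed.

Lemma dual_bounded f : exists2 M : R, 0 <= M & forall y, `|f y| <= M * `|y|.
Proof.
have /linear_boundedP [M [Mr /= HM]] :=
  continuous_linear_bounded 0 (@dual_continuous f 0).
exists (`|M| + 1) => [|y]; first by rewrite addr_ge0.
by apply: HM; rewrite (le_lt_trans (ler_norm _))// ltrDl.
Qed.

Lemma dual_normP f y : `|f y| <= dual_norm f * `|y|.
Proof.
have [->|y0] := eqVneq y 0; first by rewrite linear0 !normr0 mulr0.
rewrite -ler_pdivrMr ?normr_gt0//; apply: sup_upper_bound; last by exists y.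
split; first by exists (`|f y| / `|y|), y.
have [M M0 HM] := dual_bounded f; exists M => _ [z z0 <-].
by rewrite ler_pdivrMr ?normr_gt0.
Qed.

Lemma dual_norm_ge0 f : 0 <= dual_norm f.
Proof.
have [y0|/set0P[y y0]] := eqVneq [set y : Y | y != 0] set0.
  by rewrite /dual_norm y0 image_set0 sup0.
have := le_trans (normr_ge0 _) (dual_normP f y).
by rewrite pmulr_lge0 ?normr_gt0.
Qed.

Lemma dual_norm_le f (M : R) :
  0 <= M -> (forall y, `|f y| <= M * `|y|) -> dual_norm f <= M.
Proof.
move=> M0 HM; rewrite /dual_norm.
have [->|/set0P[y y0]] := eqVneq [set y : Y | y != 0] set0.
  by rewrite image_set0 sup0.
apply: ge_sup; first by exists (`|f y| / `|y|), y.
by move=> _ [z z0 <-]; rewrite ler_pdivrMr ?normr_gt0.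
Qed.

End DualTheory.

(** Every quotient [B w v / (|w| |v|)] is at most [dual_norm (B w) / |w|], hence so is its supremum
    over [v], and the infimum lies below the supremum at [w]. *)
Lemma infsup_le (R : realType) (X Y : normedModType R)
    (B : {linear X -> dual Y}) (w : X) :
  infsup (fun w v => B w v) * `|w| <= dual_norm (B w).
Proof.
have [->|w0] := eqVneq w 0; first by rewrite normr0 mulr0 dual_norm_ge0.
have nw : 0 < `|w| by rewrite normr_gt0.
rewrite -ler_pdivlMr//.
have up (x : X) (v : Y) : x != 0 -> v != 0 ->
    B x v / (`|x| * `|v|) <= dual_norm (B x) / `|x|.
  move=> x0 v0; have nx : 0 < `|x| by rewrite normr_gt0.
  have nv : 0 < `|v| by rewrite normr_gt0.
  rewrite invfM mulrA ler_pdivrMr// mulrAC ler_pM2r ?invr_gt0//.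
  exact: le_trans (ler_norm _) (dual_normP _ _).
pose S (x : X) := [set B x v / (`|x| * `|v|) | v in [set v : Y | v != 0]].
apply: (@le_trans _ _ (sup (S w))).
  apply: ge_inf; last by exists w.
  (* The infimum is taken over a set bounded below by 0: [v] and [- v] give opposite quotients, so
     no supremum is negative. *)
  exists 0 => _ [x x0 <-].
  have [v0|/set0P[v v0]] := eqVneq [set v : Y | v != 0] set0.
    by rewrite v0 image_set0 sup0.
  have hs : has_sup (S x).
    split; first by exists (B x v / (`|x| * `|v|)), v.
    by exists (dual_norm (B x) / `|x|) => _ [z z0 <-]; exact: up.
  have h1 : B x v / (`|x| * `|v|) <= sup (S x).
    by apply: sup_upper_bound => //; exists v.
  have h2 : - (B x v / (`|x| * `|v|)) <= sup (S x).
    apply: sup_upper_bound => //; exists (- v); first by rewrite /= oppr_eq0.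
    by rewrite linearN normrN mulNr.
  by have := lerD h1 h2; rewrite subrr -mulr2n pmulrn_lge0.
have [v0|/set0P[v v0]] := eqVneq [set v : Y | v != 0] set0.
  by rewrite /S v0 image_set0 sup0 divr_ge0// dual_norm_ge0.
apply: ge_sup; first by exists (B w v / (`|w| * `|v|)), v.
by move=> _ [z z0 <-]; exact: up.
Qed.

(** The residual is [B (u - x)], so the inf-sup estimate applies to [u - x]. *)
Lemma error_le_estimator (R : realType) (X Y : normedModType R)
    (B : {linear X -> dual Y}) (f : dual Y) (u x : X) :
  0 < infsup (fun w v => B w v) -> B u = f ->
  `|u - x| <= error_estimator B f x.
Proof.
move=> beta0 <-; rewrite /error_estimator -linearB ler_pdivlMr// mulrC.
exact: infsup_le.
Qed.

(** * Inner products that induce the norm *)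

Section InnerProduct.
Context {R : realType} {Y : normedModType R} (dot : {dot Y for idfun}).
Hypothesis normE : forall y : Y, `|y| ^+ 2 = dot y y.
Implicit Types (x y z : Y).

Lemma dotC x y : dot x y = dot y x.
Proof. by rewrite hermC expr0 mul1r. Qed.

Lemma dotDr x y z : dot x (y + z) = dot x y + dot x z.
Proof. exact: linearDr. Qed.

Lemma dotZr (a : R) x y : dot x (a *: y) = a * dot x y.
Proof. exact: linearZr_LR. Qed.

Lemma dotDl x y z : dot (x + y) z = dot x z + dot y z.
Proof. exact: linearDl. Qed.

Lemma dotZl (a : R) x y : dot (a *: x) y = a * dot x y.
Proof. exact: linearZl_LR. Qed.

Lemma normD_sqr x y : `|x + y| ^+ 2 = `|x| ^+ 2 + `|y| ^+ 2 + 2 * dot x y.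
Proof. rewrite !normE !dotDr !dotDl (dotC y x); ring. Qed.

(** Cauchy-Schwarz, obtained by squaring the triangle inequality. *)
Lemma dot_le x y : dot x y <= `|x| * `|y|.
Proof.
have /(lerXn2r 2) := ler_normD x y.
rewrite !nnegrE normr_ge0 addr_ge0// normD_sqr => /(_ isT isT); lra.
Qed.

Lemma dot_norm_le x y : `|dot x y| <= `|x| * `|y|.
Proof.
rewrite ler_norml dot_le andbT lerNl.
by rewrite -mulN1r -dotZl scaleN1r -(normrN x) dot_le.
Qed.

Lemma parallelogram x y :
  `|x + y| ^+ 2 + `|x - y| ^+ 2 = 2 * (`|x| ^+ 2 + `|y| ^+ 2).
Proof.
by rewrite !normD_sqr normrN -scaleN1r dotZr; ring.
Qed.

Lemma dot_is_dual x : (dot x : Y -> R^o) \in is_dual.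
Proof.
have lin : linear (dot x : Y -> R^o) by move=> a y z; rewrite dotDr dotZr.
rewrite inE; split=> //.
pose L : {linear Y -> R^o} := HB.pack (dot x : Y -> R^o)
  (GRing.isLinear.Build R Y R^o _ (dot x) lin).
apply: (@bounded_linear_continuous _ _ _ L); apply/linear_boundedP.
near=> r => y; apply: le_trans (dot_norm_le _ _) _.
by apply: ler_wpM2r => //; near: r; apply: nbhs_pinfty_ge; exact: num_real.
Unshelve. all: by end_near. Qed.

Definition dual_of x : dual Y := Dual (dot_is_dual x).

(** The values at [x] and [y] of the functional represented by [x - y] differ by [|x - y|^2]. *)
Lemma dual_separates x y : (forall g : dual Y, g x = g y) -> x = y.
Proof.
move=> /(_ (dual_of (x - y)))/= xy; apply/eqP; rewrite -subr_eq0 -normr_eq0.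
rewrite -sqrf_eq0 normE dotDr -scaleN1r dotZr scaleN1r xy.
by apply/eqP; ring.
Qed.

(** Cauchy-Schwarz gives the upper bound; evaluation at [y] attains it. *)
Lemma dual_norm_repr (f : dual Y) y : (forall z, f z = dot y z) ->
  dual_norm f = `|y|.
Proof.
move=> fy; apply/eqP; rewrite eq_le; apply/andP; split.
  by apply: dual_norm_le => // z; rewrite fy dot_norm_le.
have [->|y0] := eqVneq y 0; first by rewrite normr0 dual_norm_ge0.
have := dual_normP f y; rewrite fy -normE ger0_norm ?sqr_ge0// expr2.
by rewrite ler_pM2r ?normr_gt0.
Qed.

Lemma dual_dot_repr (f g : dual Y) y z :
  (forall v, f v = dot y v) -> (forall v, g v = dot z v) ->
  dual_dot f g = dot y z.
Proof.
move=> fy gz; rewrite /dual_dot (@dual_norm_repr _ (y + z)); last first.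
  by move=> v; rewrite dotDl -fy -gz.
rewrite (@dual_norm_repr _ (y - z)); last first.
  by move=> v; rewrite dotDl -(scaleN1r z) dotZl mulN1r -fy -gz.
by rewrite !normD_sqr normrN -(scaleN1r z) dotZr; field.
Qed.

End InnerProduct.

(** * Riesz representation and the two Riesz operators *)

Section Riesz.
Context {R : realType} {Y : completeNormedModType R} (dot : {dot Y for idfun}).
Hypothesis normE : forall y : Y, `|y| ^+ 2 = dot y y.
Implicit Types (f g : dual Y) (x y z : Y).

(* Minimize the energy [|y|^2 - 2 f y]: by the parallelogram law its sublevel
   sets shrink, so they form a Cauchy filter, whose limit is the minimizer. *)
Lemma riesz_representation f : exists y, forall z, f z = dot y z.
Proof.
pose J y : R := `|y| ^+ 2 - 2 * f y.
have [M M0 fM] := dual_bounded f.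
have Jlb : has_lbound (range J).
  (* Complete the square: [|y|^2 - 2 M |y| = (|y| - M)^2 - M^2]. *)
  exists (- M ^+ 2) => _ [y _ <-]; rewrite /J.
  have := ler_norm (f y); have := fM y; have := sqr_ge0 (`|y| - M); nra.
pose m := inf (range J).
have mJ y : m <= J y by apply: ge_inf => //; exists y.
have ex_lt (e : R) : 0 < e -> exists y, J y < m + e.
  move=> e0.
  have /(inf_adherent e0)[_ [y _ <-] ?] : has_inf (range J).
    by split=> //; exists (J 0), 0.
  by exists y.
have close x y (e : R) : J x < m + e -> J y < m + e ->
    `|x - y| ^+ 2 < 4 * e.
  (* With [h] the midpoint of [x] and [y], [J x + J y - 2 J h = |x - y|^2 / 2], and [J h >= m]. *)
  move=> Jx Jy; have := mJ (2^-1 *: (x + y)).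
  have := parallelogram normE x y.
  rewrite /J in Jx Jy *; rewrite dualZ dualD normrZ ger0_norm//= exprMn.
  lra.
pose F : set_system Y :=
  filter_from [set e : R | 0 < e] (fun e => [set y | J y < m + e]).
have FF : ProperFilter F.
  apply: filter_from_proper; last by move=> e /ex_lt.
  apply: filter_from_filter; first by exists 1 => /=.
  move=> d e d0 e0; exists (Num.min d e) => /=; first by rewrite lt_min d0.
  move=> y /= Jy; split; apply: (lt_le_trans Jy); rewrite lerD2l.
    by rewrite ge_min lexx.
  by rewrite ge_min lexx orbT.
have Fcauchy : cauchy F.
  apply: cauchy_exP => e e0.
  (* At this level [close] yields [|x - y|^2 < e^2 / 2]. *)
  have e8 : 0 < e ^+ 2 / 8 by rewrite divr_gt0 ?exprn_gt0.
  have [x Jx] := ex_lt _ e8; exists x; exists (e ^+ 2 / 8) => // y /= Jy.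
  rewrite -ball_normE /= -(@ltr_pXn2r _ 2)// ?nnegrE// ?ltW//.
  have := close _ _ _ Jx Jy; have := sqr_ge0 e; lra.
have /cauchy_cvgP/cvg_ex[y Fy] := Fcauchy.
have Jcont : continuous J.
  move=> z; apply: cvgB.
    by apply: cvgM; exact: norm_continuous.
  by apply: cvgMr; exact: dual_continuous.
have Jy : J y <= m.
  apply/ler_addgt0Pr => e e0.
  apply: (@closed_cvg _ _ F FF J _ (@closed_le _ (m + e)) _ (J y)).
    by exists e => // z /= /ltW.
  by apply: continuous_cvg => //; exact: Jcont.
exists y => z.
(* Minimality of [y] along the line [y + t z]. *)
have var (t : R) : 0 <= t ^+ 2 * `|z| ^+ 2 + 2 * t * (dot y z - f z).
  have := le_trans Jy (mJ (y + t *: z)).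
  rewrite /J (normD_sqr normE) dualD dualZ dotZr normrZ exprMn.
  rewrite real_normK ?num_real//=.
  lra.
set a := dot y z - f z in var.
(* The optimal step [- a / |z|^2], with [+ 1] to allow [z = 0]. *)
have := var (- a / (`|z| ^+ 2 + 1)).
have c0 : 0 < `|z| ^+ 2 + 1 by rewrite ltr_wpDl ?sqr_ge0.
set c := `|z| ^+ 2 in c0 var *.
have -> : (- a / (c + 1)) ^+ 2 * c + 2 * (- a / (c + 1)) * a =
  - (a ^+ 2 * (c + 2) / (c + 1) ^+ 2) by field; rewrite gt_eqF.
rewrite oppr_ge0 ler_pdivrMr ?exprn_gt0// mul0r pmulr_lle0; last by lra.
by rewrite exprn_even_le0//= subr_eq0 => /eqP.
Qed.

(** The representative satisfies the equation behind [xget] by polarization, and is its only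
    solution since functionals separate points. *)
Lemma rieszE f y : (forall z, f z = dot y z) -> riesz f = y.
Proof.
move=> fy; have hy (g : dual Y) : g y = dual_dot f g.
  have [z gz] := riesz_representation g.
  by rewrite gz (dual_dot_repr normE fy gz) dotC.
apply: xget_unique => [g|x hx]; first exact: hy.
by apply: (dual_separates normE) => g; rewrite hx hy.
Qed.

(** Symmetry of [dot] makes the Riesz operator its own adjoint. *)
Lemma riesz_adjE f y : (forall z, f z = dot y z) -> riesz_adj f = y.
Proof.
move=> fy; have hy (g : dual Y) : g y = f (riesz g).
  have [z gz] := riesz_representation g.
  by rewrite (rieszE gz) gz fy dotC.
apply: xget_unique => [g|x hx]; first exact: hy.
by apply: (dual_separates normE) => g; rewrite hx hy.
Qed.

End Riesz.

(** * Spans, and minimality of the Petrov-Galerkin residual *)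

Lemma lin_spanB (R : realType) (X : lmodType R) (s : seq X) (x y : X) :
  lin_span s x -> lin_span s y -> lin_span s (x - y).
Proof.
move=> [c ->] [d ->]; exists (fun i => c i - d i).
by rewrite -sumrB; apply: eq_bigr => i _; rewrite scalerBl.
Qed.

Lemma mem_lin_span (R : realType) (X : lmodType R) (s : seq X) (x : X) :
  x \in s -> lin_span s x.
Proof.
move=> xs; have ks : (index x s < size s)%N by rewrite index_mem.
(* Only the first occurrence of [x] gets coefficient 1, as [s] may have repetitions. *)
exists (fun i => (i == Ordinal ks)%:R).
rewrite (bigD1 (Ordinal ks))//= eqxx scale1r nth_index// big1 ?addr0// => i.
by move=> /negPf ->; rewrite scale0r.
Qed.

Section ResidualMinimization.
Context {R : realType} {X : normedModType R} {Y : completeNormedModType R}.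
Context (dot : {dot Y for idfun}).
Hypothesis normE : forall y : Y, `|y| ^+ 2 = dot y y.

(* The Petrov-Galerkin equations say that the Riesz representative of the
   residual is orthogonal to those of [B z], [z] in [Xn]; apply Pythagoras. *)
Lemma petrov_galerkin_min (B : {linear X -> dual Y}) (f : dual Y)
    (Xn : set X) (x z : X) :
  (forall v w, Xn v -> Xn w -> Xn (v - w)) ->
  petrov_galerkin B f Xn x -> Xn z ->
  dual_norm (f - B x) <= dual_norm (f - B z).
Proof.
move=> XnB [Xx PG] Xz.
have [r rE] := riesz_representation normE (f - B x).
have [q qE] := riesz_representation normE (B (x - z)).
(* [q] is the admissible test function [riesz_adj (B (x - z))]. *)
have rq : dot r q = 0.
  rewrite -rE dualB PG ?subrr//; exists (x - z); first exact: XnB.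
  exact: (riesz_adjE normE qE).
(* [r + q] represents [f - B z = (f - B x) + B (x - z)]. *)
rewrite (dual_norm_repr normE rE) (@dual_norm_repr _ _ _ normE _ (r + q)).
  rewrite -(@ler_pXn2r _ 2)// ?nnegrE// (normD_sqr normE) rq mulr0 addr0.
  by rewrite lerDl sqr_ge0.
move=> v; rewrite dotDl -rE -qE (linearB B x z) !dualB; ring.
Qed.

End ResidualMinimization.

(** * Error bound at termination, and repeated selection *)

Theorem theorem3p13 (R : realType) (X Y : completeNormedModType R)
  (dotX : {dot X for idfun}) (dotY : {dot Y for idfun})
  (normX : forall x : X, `|x| ^+ 2 = dotX x x)
  (normY : forall y : Y, `|y| ^+ 2 = dotY y y)
  (P : nat) (D : set 'rV[R]_P) (Dtrain : {fset 'rV[R]_P})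
  (DtrainD : forall mu, mu \in Dtrain -> D mu)
  (B : 'rV[R]_P -> {linear X -> dual Y}) (f : 'rV[R]_P -> dual Y)
  (u : 'rV[R]_P -> X)
  (gamma : 'rV[R]_P -> R) (gammaUB betaLB : R)
  (B_bounded : forall mu, D mu -> forall (w : X) (v : Y),
     B mu w v <= gamma mu * `|w| * `|v|)
  (gamma_le : forall mu, D mu -> gamma mu <= gammaUB)
  (betaLB_gt0 : 0 < betaLB)
  (beta := fun mu => infsup (fun (w : X) (v : Y) => B mu w v))
  (beta_sym : forall mu, D mu ->
     beta mu = infsup (fun (v : Y) (w : X) => B mu w v))
  (beta_ge : forall mu, D mu -> betaLB <= beta mu)
  (u_sol : forall mu, D mu -> B mu (u mu) = f mu)
  (tol cD CD : R) (tol_gt0 : 0 < tol) (cD_gt0 : 0 < cD) (cD_le : cD <= CD)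
  (eps := fun mu => tol * (cD / CD) * beta mu)
  (ueps : 'rV[R]_P -> X)
  (snapshot : forall mu, D mu ->
     residual_error (B mu) (u mu) (ueps mu) <= eps mu)
  (Nmax : nat) (mu_ : nat -> 'rV[R]_P) (est : nat -> 'rV[R]_P -> R)
  (un : nat -> 'rV[R]_P -> X)
  (Xn := fun n => lin_span [seq ueps mu | mu <- selected mu_ n])
  (run : greedy_run Dtrain Nmax (cD * tol) est mu_)
  (un_PG : forall n, reached Nmax (cD * tol) est mu_ n ->
     forall mu, D mu -> petrov_galerkin (B mu) (f mu) (Xn n) (un n mu))
  (est_bounds : forall n, reached Nmax (cD * tol) est mu_ n ->
     forall mu, D mu ->
       cD * error_estimator (B mu) (f mu) (un n mu) <= est n mu
         <= CD * error_estimator (B mu) (f mu) (un n mu)) :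
  (forall N, terminates Nmax (cD * tol) est mu_ N ->
     \big[Num.max/0]_(mu <- Dtrain) `|u mu - un N mu| < tol)
  /\
  (forall n, executed Nmax (cD * tol) est mu_ n ->
     mu_ n.+1 \in selected mu_ n ->
     (exists N, terminates Nmax (cD * tol) est mu_ N)
     \/ (est n (mu_ n.+1) = cD * tol
         /\ residual_error (B (mu_ n.+1)) (u (mu_ n.+1)) (ueps (mu_ n.+1))
            = eps (mu_ n.+1))).
Proof.
have CD0 : 0 < CD := lt_le_trans cD_gt0 cD_le.
have beta_gt0 mu : D mu -> 0 < beta mu.
  by move=> /beta_ge; exact: lt_le_trans.
split.
  move=> N execstopN; have [execN stopN] := execstopN.
  (* The initial value 0 of the maximum is below [tol] as well. *)
  rewrite big_seq; apply: (big_ind (fun x : R => x < tol)) => //.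
    by move=> x y xt yt; rewrite gt_max xt yt.
  move=> mu muT; have Dmu : D mu by exact: DtrainD.
  have err := error_le_estimator (un N mu) (beta_gt0 _ Dmu) (u_sol _ Dmu).
  apply: le_lt_trans err _.
  rewrite -(ltr_pM2l cD_gt0); apply: le_lt_trans stopN.
  have /andP[le_est _] := est_bounds _ execN.1 _ Dmu.
  have [_ max_est] := run _ execN.
  exact: le_trans le_est (max_est _ muT).
move=> n execn; set mu := mu_ n.+1 => mu_sel.
have Dmu : D mu by apply: DtrainD; exact: (run _ execn).1.
have betamu := beta_gt0 _ Dmu.
(* The snapshot of a parameter selected before lies in [Xn n], so it competes in the residual
   minimization. *)
have res_le : dual_norm (f mu - B mu (un n mu)) <=
    residual_error (B mu) (u mu) (ueps mu).
  rewrite /residual_error linearB/= u_sol//.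
  apply: (petrov_galerkin_min normY _ (un_PG _ execn.1 _ Dmu)).
    by move=> v w; exact: lin_spanB.
  by apply: mem_lin_span; exact: map_f.
have est_le : est n mu <=
    CD * (residual_error (B mu) (u mu) (ueps mu) / beta mu).
  have /andP[_ /le_trans] := est_bounds _ execn.1 _ Dmu; apply.
  by rewrite ler_pM2l// ler_pM2r// invr_gt0.
(* The factors [cD / CD] and [beta] in [eps] are chosen for this cancellation. *)
have eps_tol : CD * (eps mu / beta mu) = cD * tol.
  by rewrite /eps; field; rewrite !gt_eqF.
(* The bounds give only [est n mu <= cD * tol], whereas stopping needs a strict inequality; without
   it, the whole chain of bounds collapses to equalities. *)
have [est_lt|est_ge] := ltP (est n mu) (cD * tol); first by left; exists n.
right; have snap := snapshot _ Dmu; split.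
  apply/eqP; rewrite eq_le est_ge andbT (le_trans est_le)// -eps_tol.
  by rewrite ler_pM2l// ler_pM2r ?invr_gt0.
apply/eqP; rewrite eq_le snap/=.
have := le_trans est_ge est_le.
by rewrite -eps_tol ler_pM2l// ler_pM2r// invr_gt0.
Qed.
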